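(* Let $r_0\ge2$ be an integer. Let $(\tilde f_t)$ be a $C^{r_0,r_0}$ perturbation of a piecewise expanding $C^{r_0}$ unimodal map $f$, such that for each small $t$ there exists a homeomorphism $h_t$ of $I$ with $h_t(c)=c$ and $\tilde f_t=h_t\circ f\circ h_t^{-1}$. Then for small enough $\epsilon>0$ the map $(t,x)\mapsto h_t(x)$ is continuous from $(-\epsilon,\epsilon)\times I$ to $\mathbb R$, and the maps $t\mapsto h_t(x)$ are $C^{r_0-1+Lip}$ on $[-\epsilon,\epsilon]$, uniformly in $x\in I$, i.e. $$\sup_{x\in I}\|h_{\cdot}(x)\|_{C^{r_0-1+Lip}([-\epsilon,\epsilon])}<\infty .$$
   Context: $C^{k+Lip}$ denotes $C^k$ functions whose $k$-th derivative is Lipschitz, with the usual norm. Fix $I=[a,b]$, $a<c<b$, $I_+=[a,c]$, $I_-=[c,b]$. For $r\ge1$, a piecewise expanding $C^r$ unimodal map is a continuous $f:I\to I$, strictly increasing on $I_+$, strictly decreasing on $I_-$, with $f(a)=f(b)=a$, such that for $\sigma=\pm$ the map $f|_{I_\sigma}$ extends to a $C^r$ map on a neighbourhood of $I_\sigma$ and $\inf|f'|_{I_\sigma}|>1$. For integers $r\ge r_0\ge2$, a $C^{r_0,r}$ perturbation of such an $f$ is a family of piecewise expanding $C^r$ unimodal maps $f_t:I\to I$, $|t|<\epsilon_*$ for some $\epsilon_*>0$ (same $a,c,b$), with $f_0=f$, such that: for $\sigma=\pm$ there is a neighbourhood $\mathcal I_\sigma$ of $I_\sigma$ on which the extensions of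 $f_t|_{I_\sigma}$ have $C^r$ norm uniformly bounded for small $|t|$ and satisfy $\|(f-f_t)|_{\mathcal I_\sigma}\|_{C^{r-1}}=O(t)$; and $(x,t)\mapsto f_t(x)$, on each of $x\in I_+$, $x\in I_-$, extends to a $C^{r_0}$ function on a neighbourhood of $I_\sigma\times\{0\}$. *)

(* Defs.v *)
(* Classical real numbers of the standard library, with Coquelicot. *)
From Stdlib Require Export Reals.
From Coquelicot Require Export Coquelicot.
Open Scope R_scope.

(* Maps of a closed interval are represented by total functions [R -> R]; only
   their values on the interval are ever constrained or used. *)

Definition Icc (a b : R) : R -> Prop := fun x => a <= x <= b.

Definition maps_to (D E : R -> Prop) (f : R -> R) : Prop :=
  forall x, D x -> E (f x).

Definition agree_on (D : R -> Prop) (f g : R -> R) : Prop :=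
  forall x, D x -> f x = g x.

(* All derivatives below are two-sided.  So [D] should be open, or [f] should
   be meaningful on a neighbourhood of [D]. *)

Definition derivable_upto (k : nat) (D : R -> Prop) (f : R -> R) : Prop :=
  forall j x, (j <= k)%nat -> D x -> ex_derive_n f j x.

Definition Ck (k : nat) (U : R -> Prop) (f : R -> R) : Prop :=
  derivable_upto k U f /\ (forall x, U x -> continuous (Derive_n f k) x).

Definition lipschitz_on (D : R -> Prop) (f : R -> R) : Prop :=
  exists L : R, forall x y, D x -> D y -> Rabs (f x - f y) <= L * Rabs (x - y).

Definition CkLip (k : nat) (D : R -> Prop) (f : R -> R) : Prop :=
  derivable_upto k D f /\ lipschitz_on D (Derive_n f k).

Definition Ck_values (k : nat) (D : R -> Prop) (f : R -> R) : R -> Prop :=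
  fun y => exists j x, (j <= k)%nat /\ D x /\ y = Rabs (Derive_n f j x).

Definition slopes (D : R -> Prop) (f : R -> R) : R -> Prop :=
  fun y => exists u v, D u /\ D v /\ u <> v /\ y = Rabs (f u - f v) / Rabs (u - v).

(* max_{j <= k} sup_D |f^(j)|, possibly infinite *)
Definition Ck_norm (k : nat) (D : R -> Prop) (f : R -> R) : Rbar :=
  Lub_Rbar (Ck_values k D f).

(* max of the C^k norm and of the best Lipschitz constant of f^(k) *)
Definition CkLip_norm (k : nat) (D : R -> Prop) (f : R -> R) : Rbar :=
  Lub_Rbar (fun y => Ck_values k D f y \/ slopes D (Derive_n f k) y).

Definition partial1 (F : R * R -> R) : R * R -> R :=
  fun p => Derive (fun x => F (x, snd p)) (fst p).

Definition partial2 (F : R * R -> R) : R * R -> R :=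
  fun p => Derive (fun t => F (fst p, t)) (snd p).

(* For [W] open: all iterated partial derivatives of order at most [k], taken
   in any order, exist and are continuous on [W]. *)
Fixpoint Ck2 (k : nat) (W : R * R -> Prop) (F : R * R -> R) : Prop :=
  (forall p, W p -> continuous F p) /\
  match k with
  | O => True
  | S k' =>
      (forall p, W p -> ex_derive (fun x => F (x, snd p)) (fst p)
                     /\ ex_derive (fun t => F (fst p, t)) (snd p)) /\
      Ck2 k' W (partial1 F) /\ Ck2 k' W (partial2 F)
  end.

(* [f' ] on [J] is the derivative of the extension; at the end points of [J]
   it is the one-sided derivative of [f], whatever the extension. *)
Definition expanding_Cr_branch (r : nat) (J : R -> Prop) (f : R -> R) : Prop :=
  exists (U : R -> Prop) (F : R -> R),
    open U /\ (forall x, J x -> U x) /\ agree_on J F f /\ Ck r U F /\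
    Rbar_lt 1 (Glb_Rbar (fun y => exists x, J x /\ y = Rabs (Derive F x))).

Record pw_expanding_unimodal (a c b : R) (r : nat) (f : R -> R) : Prop := {
  unimodal_maps : maps_to (Icc a b) (Icc a b) f;
  unimodal_continuous : continuous_on (Icc a b) f;
  unimodal_increasing :
    forall x y, Icc a c x -> Icc a c y -> x < y -> f x < f y;
  unimodal_decreasing :
    forall x y, Icc c b x -> Icc c b y -> x < y -> f y < f x;
  unimodal_left : f a = a;
  unimodal_right : f b = a;
  unimodal_branch_plus : expanding_Cr_branch r (Icc a c) f;
  unimodal_branch_minus : expanding_Cr_branch r (Icc c b) f
}.

(* [F t] is the extension of the restriction of [ft t] to [J]; since
   [ft 0 = f], the extension of [f] is [F 0]. *)
Definition uniform_Cr_extensions (r : nat) (J : R -> Prop) (ft : R -> R -> R) : Prop :=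
  exists (U : R -> Prop) (F : R -> R -> R) (delta M K : R),
    open U /\ (forall x, J x -> U x) /\ 0 < delta /\
    forall t, Rabs t < delta ->
      agree_on J (F t) (ft t) /\ Ck r U (F t) /\
      Rbar_le (Ck_norm r U (F t)) M /\
      Rbar_le (Ck_norm (r - 1) U (fun x => F 0 x - F t x)) (K * Rabs t).

Definition joint_Cr_extension (r0 : nat) (J : R -> Prop) (eps : R)
    (ft : R -> R -> R) : Prop :=
  exists (W : R * R -> Prop) (G : R * R -> R),
    open W /\ (forall x, J x -> W (x, 0)) /\ Ck2 r0 W G /\
    forall x t, J x -> Rabs t < eps -> W (x, t) -> G (x, t) = ft t x.

Definition perturbation (a c b : R) (r0 r : nat) (f : R -> R)
    (ft : R -> R -> R) : Prop :=
  exists eps : R, 0 < eps /\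
    (forall t, Rabs t < eps -> pw_expanding_unimodal a c b r (ft t)) /\
    agree_on (Icc a b) (ft 0) f /\
    uniform_Cr_extensions r (Icc a c) ft /\
    uniform_Cr_extensions r (Icc c b) ft /\
    joint_Cr_extension r0 (Icc a c) eps ft /\
    joint_Cr_extension r0 (Icc c b) eps ft.

Record homeomorphism_with_inverse (D : R -> Prop) (h g : R -> R) : Prop := {
  homeo_maps : maps_to D D h;
  homeo_inv_maps : maps_to D D g;
  homeo_continuous : continuous_on D h;
  homeo_inv_continuous : continuous_on D g;
  homeo_cancel_l : forall x, D x -> g (h x) = x;
  homeo_cancel_r : forall x, D x -> h (g x) = x
}.

(* Main.v *)
(** Write u_x(t) = h_t(x).  Since h_t is a homeomorphism fixing c, and since
    f(c) > c and f_t(c) > c by expansion, h_t preserves both I_+ and I_-;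
    hence u_{f(x)}(t) = G(u_x(t), t), where G is the joint extension of the
    branch whose domain contains x.  As |dG/dx| >= lam > 1, a bounded family e
    with lam |e_x| <= |e_{f(x)}| + C satisfies sup |e| <= C / (lam - 1).  This
    principle, used along the orbits of f without ever inverting a branch,
    makes the family u uniformly Lipschitz in t and then, applied to
    differences of difference quotients, uniformly differentiable.  The
    derivative solves the linear equation
      u'_{f(x)} = G_x(u_x, t) u'_x + G_t(u_x, t),
    whose bounded solutions are as regular as its coefficients, by the same
    argument.  Each derivative gained on u is a derivative gained on the
    coefficients, until the regularity of G_x and G_t is exhausted. *)
Require Import Defs.
From Stdlib Require Import Reals Lra Lia ClassicalEpsilon.
From Coquelicot Require Import Coquelicot.
Open Scope R_scope.

(** * Expanding recursions *)

Lemma mean_value (f df : R -> R) (x y : R) :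
  (forall z, Rmin x y <= z <= Rmax x y -> is_derive f z (df z)) ->
  exists z, Rmin x y <= z <= Rmax x y /\ f y - f x = df z * (y - x).
Proof.
  intros Hd. apply MVT_gen.
  - intros z Hz. apply Hd. lra.
  - intros z Hz. apply continuity_pt_filterlim.
    apply (ex_derive_continuous f z). exists (df z). now apply Hd.
Qed.

Lemma between_abs (x y z e : R) :
  Rmin x y <= z <= Rmax x y -> Rabs x < e -> Rabs y < e -> Rabs z < e.
Proof.
  intros Hz Hx Hy.
  apply Rabs_def2 in Hx; apply Rabs_def2 in Hy.
  unfold Rmin, Rmax in Hz. destruct (Rle_dec x y); apply Rabs_def1; lra.
Qed.

Lemma between_dist (x y z : R) :
  Rmin x y <= z <= Rmax x y -> Rabs (z - x) <= Rabs (y - x).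
Proof.
  unfold Rmin, Rmax. destruct (Rle_dec x y); intros Hz.
  - rewrite !Rabs_pos_eq; lra.
  - rewrite !Rabs_left1; lra.
Qed.

(** The error divided by [s - t] is at most [C * Rabs (s - t)], which tends to 0. Taylor estimates
    become derivatives through this lemma; [C] carries no sign condition, so the proof works with
    [Rabs C + 1]. *)
Lemma is_derive_quadratic (f : R -> R) (t l C d : R) :
  0 < d ->
  (forall s, Rabs (s - t) < d ->
     Rabs (f s - f t - l * (s - t)) <= C * Rabs (s - t) ^ 2) ->
  is_derive f t l.
Proof.
  intros Hd Hq. apply is_derive_Reals. intros eps Heps.
  assert (HC : 0 < Rabs C + 1) by (pose proof (Rabs_pos C); lra).
  assert (Hm : 0 < Rmin d (eps / (Rabs C + 1))).
  { apply Rmin_pos; [ easy | now apply Rdiv_lt_0_compat ]. }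
  exists (mkposreal _ Hm). simpl. intros k Hk Hkd.
  pose proof (Rmin_l d (eps / (Rabs C + 1))).
  pose proof (Rmin_r d (eps / (Rabs C + 1))).
  specialize (Hq (t + k)). replace (t + k - t) with k in Hq by ring.
  specialize (Hq ltac:(lra)).
  replace ((f (t + k) - f t) / k - l)
    with ((f (t + k) - f t - l * k) / k) by now field.
  assert (Hpk : 0 < Rabs k) by now apply Rabs_pos_lt.
  rewrite Rabs_div by easy.
  apply Rle_lt_trans with ((Rabs C + 1) * Rabs k).
  - apply Rmult_le_reg_r with (Rabs k); [ easy | ].
    unfold Rdiv. rewrite Rmult_assoc, Rinv_l, Rmult_1_r by lra.
    pose proof (Rle_abs C). nra.
  - replace eps with ((Rabs C + 1) * (eps / (Rabs C + 1))) by (field; lra).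
    apply Rmult_lt_compat_l; lra.
Qed.

(** The difference quotients along the given points converge to [l]. One such point at each scale
    suffices, so they may all lie on one side of [t]; this allows end points of a segment. *)
Lemma derive_le_slope (f : R -> R) (t l L : R) :
  is_derive f t l ->
  (forall e, 0 < e ->
     exists s, s <> t /\ Rabs (s - t) < e /\
               Rabs (f s - f t) <= L * Rabs (s - t)) ->
  Rabs l <= L.
Proof.
  intros Hf Hs. apply Rnot_lt_le. intros Hlt.
  apply is_derive_Reals in Hf.
  destruct (Hf (Rabs l - L)) as [[e He] Hq]; [ lra | ].
  destruct (Hs e He) as (s & Hst & Hse & Hsl).
  specialize (Hq (s - t) ltac:(lra) Hse).
  replace (t + (s - t)) with s in Hq by ring.
  assert (Hp : 0 < Rabs (s - t)) by (apply Rabs_pos_lt; lra).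
  assert (Hd : Rabs ((f s - f t) / (s - t)) <= L).
  { rewrite Rabs_div by lra. apply Rmult_le_reg_r with (Rabs (s - t)); [ easy | ].
    unfold Rdiv. rewrite Rmult_assoc, Rinv_l; lra. }
  pose proof (Rabs_triang_inv l (l - (f s - f t) / (s - t))) as Ht.
  replace (l - (l - (f s - f t) / (s - t)))
    with ((f s - f t) / (s - t)) in Ht by ring.
  rewrite <- Rabs_Ropp in Hq.
  replace (- ((f s - f t) / (s - t) - l))
    with (l - (f s - f t) / (s - t)) in Hq by ring.
  lra.
Qed.

(** With s the supremum of [q] over [D], the recursion gives lam s <= s + C. The a priori bound [B]
    makes s finite and then disappears from the estimate. *)
Lemma expanding_sup {X : Type} (D : X -> Prop) (phi : X -> X) (q : X -> R)
    (lam C B : R) :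
  (forall x, D x -> D (phi x)) -> 1 < lam ->
  (forall x, D x -> q x <= B) ->
  (forall x, D x -> lam * q x <= q (phi x) + C) ->
  forall x, D x -> q x <= C / (lam - 1).
Proof.
  intros Hphi Hlam HB Hq x0 Hx0.
  destruct (completeness (fun y => exists x, D x /\ y = q x)) as [s [Hub Hlub]].
  - exists B. intros y (x & Hx & ->). auto.
  - exists (q x0). eauto.
  - assert (Hs : s <= (s + C) / lam).
    { apply Hlub. intros y (x & Hx & ->).
      assert (q (phi x) <= s) by (apply Hub; eauto).
      apply Rmult_le_reg_l with lam; [ lra | ].
      replace (lam * ((s + C) / lam)) with (s + C) by (field; lra).
      specialize (Hq x Hx). lra. }
    assert (Hx : q x0 <= s) by (apply Hub; eauto).
    apply Rle_trans with s; [ easy | ].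
    apply Rmult_le_compat_l with (r := lam) in Hs; [ | lra ].
    replace (lam * ((s + C) / lam)) with (s + C) in Hs by (field; lra).
    apply Rmult_le_reg_l with (lam - 1); [ lra | ].
    replace ((lam - 1) * (C / (lam - 1))) with C by (field; lra). lra.
Qed.

(* The difference quotients of [w x] at [t] satisfy the expanding recursion up
   to an error [O(s - t)], so two of them differ by [O(|s - t| + |s' - t|)],
   uniformly in [x]: they are Cauchy. *)
Lemma expanding_differentiable {X : Type} (D : X -> Prop) (phi : X -> X)
    (w : X -> R -> R) (a b : X -> R) (lam C L delta t : R) :
  (forall x, D x -> D (phi x)) -> 1 < lam -> Rabs t < delta ->
  (forall x, D x -> lam <= Rabs (a x)) ->
  (forall x s, D x -> Rabs s < delta ->
     Rabs (w x s - w x t) <= L * Rabs (s - t)) ->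
  (forall x s, D x -> Rabs s < delta ->
     Rabs (w (phi x) s - w (phi x) t - a x * (w x s - w x t) - b x * (s - t))
       <= C * Rabs (s - t) ^ 2) ->
  forall x, D x ->
    ex_derive (w x) t /\ Rabs (Derive (w x) t) <= L /\
    Derive (w (phi x)) t = a x * Derive (w x) t + b x.
Proof.
  intros Hphi Hlam Ht Ha HL HC.
  assert (Hnear : forall s, Rabs (s - t) < delta - Rabs t -> Rabs s < delta).
  { intros s Hs. pose proof (Rabs_triang (s - t) t).
    replace (s - t + t) with s in H by ring. lra. }
  assert (Hcauchy : forall s s', s <> t -> s' <> t ->
    Rabs s < delta -> Rabs s' < delta -> forall x, D x ->
    Rabs ((w x s - w x t) / (s - t) - (w x s' - w x t) / (s' - t))
      <= C * (Rabs (s - t) + Rabs (s' - t)) / (lam - 1)).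
  { intros s s' Hs Hs' Hsd Hsd'.
    assert (Hdq : forall s, s <> t -> Rabs s < delta -> forall x, D x ->
      Rabs ((w (phi x) s - w (phi x) t) / (s - t)
            - a x * ((w x s - w x t) / (s - t)) - b x) <= C * Rabs (s - t)
      /\ Rabs ((w x s - w x t) / (s - t)) <= L).
    { clear s s' Hs Hs' Hsd Hsd'. intros s Hs Hsd x Hx.
      assert (Hp : 0 < Rabs (s - t)) by (apply Rabs_pos_lt; lra).
      split; apply Rmult_le_reg_r with (Rabs (s - t)); try easy.
      - rewrite <- Rabs_mult. specialize (HC x s Hx Hsd).
        match goal with |- Rabs ?e <= _ => replace e with
          (w (phi x) s - w (phi x) t - a x * (w x s - w x t) - b x * (s - t))
          by (field; lra) end. lra.
      - rewrite <- Rabs_mult. specialize (HL x s Hx Hsd).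
        match goal with |- Rabs ?e <= _ => replace e with
          (w x s - w x t) by (field; lra) end. lra. }
    apply (expanding_sup D phi (fun x => Rabs ((w x s - w x t) / (s - t)
                      - (w x s' - w x t) / (s' - t))) lam _ (L + L)); auto.
    - intros x Hx. destruct (Hdq s Hs Hsd x Hx) as [_ H1].
      destruct (Hdq s' Hs' Hsd' x Hx) as [_ H2].
      unfold Rminus at 1. eapply Rle_trans; [ apply Rabs_triang | ].
      rewrite Rabs_Ropp. lra.
    - intros x Hx. destruct (Hdq s Hs Hsd x Hx) as [H1 _].
      destruct (Hdq s' Hs' Hsd' x Hx) as [H2 _].
      set (p := (w x s - w x t) / (s - t)) in *.
      set (p' := (w x s' - w x t) / (s' - t)) in *.
      set (q := (w (phi x) s - w (phi x) t) / (s - t)) in *.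
      set (q' := (w (phi x) s' - w (phi x) t) / (s' - t)) in *.
      apply Rle_trans with (Rabs (a x * (p - p'))).
      { rewrite Rabs_mult. apply Rmult_le_compat_r; [ apply Rabs_pos | auto ]. }
      (* The inhomogeneous term [b x] cancels in the difference of the two recursions, leaving only
         their errors. *)
      replace (a x * (p - p'))
        with ((q - q') + (- (q - a x * p - b x) + (q' - a x * p' - b x))) by ring.
      eapply Rle_trans; [ apply Rabs_triang | ]. apply Rplus_le_compat_l.
      eapply Rle_trans; [ apply Rabs_triang | ]. rewrite Rabs_Ropp. lra. }
  assert (Hex : forall x, D x -> ex_derive (w x) t).
  { intros x Hx.
    assert (Hproper : ProperFilter (locally' t)) by exact (Rbar_locally'_filter t).
    destruct (proj1 (filterlim_locally_cauchy (U := R_CompleteSpace) (F := locally' t)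
      (fun s => (w x s - w x t) / (s - t)))) as [v Hv].
    - intros [eps Heps].
      assert (HC1 : 0 < Rabs C + 1) by (pose proof (Rabs_pos C); lra).
      (* Chosen so that the Cauchy bound with both distances below [e], namely 2 C e / (lam - 1),
         stays below [eps]. *)
      set (e := Rmin (delta - Rabs t) (eps * (lam - 1) / (2 * (Rabs C + 1)))).
      assert (He : 0 < e).
      { apply Rmin_pos; [ lra | ]. apply Rdiv_lt_0_compat; [ | lra ].
        apply Rmult_lt_0_compat; lra. }
      exists (fun s => Rabs (s - t) < e /\ s <> t). split.
      + exists (mkposreal e He). intros s Hs Hst. now split.
      + intros s s' [Hs Hst] [Hs' Hst'].
        pose proof (Rmin_l (delta - Rabs t) (eps * (lam - 1) / (2 * (Rabs C + 1)))).
        pose proof (Rmin_r (delta - Rabs t) (eps * (lam - 1) / (2 * (Rabs C + 1)))).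
        fold e in H, H0.
        change (Rabs ((w x s' - w x t) / (s' - t) - (w x s - w x t) / (s - t)) < eps).
        eapply Rle_lt_trans.
        { apply Hcauchy; auto; apply Hnear; lra. }
        apply Rmult_lt_reg_r with (lam - 1); [ lra | ].
        unfold Rdiv. rewrite Rmult_assoc, Rinv_l, Rmult_1_r by lra.
        apply Rle_lt_trans with ((Rabs C) * (Rabs (s' - t) + Rabs (s - t))).
        { apply Rmult_le_compat_r; [ | apply Rle_abs ].
          pose proof (Rabs_pos (s' - t)); pose proof (Rabs_pos (s - t)); lra. }
        apply Rle_lt_trans with (Rabs C * (2 * e)).
        { apply Rmult_le_compat_l; [ apply Rabs_pos | lra ]. }
        apply Rlt_le_trans with ((Rabs C + 1) * (2 * e)).
        { nra. }
        apply Rle_trans with ((Rabs C + 1) * (2 * (eps * (lam - 1) / (2 * (Rabs C + 1))))).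
        { apply Rmult_le_compat_l; lra. }
        right. field. lra.
    - exists v. apply is_derive_Reals. intros eps Heps.
      destruct (proj1 (filterlim_locally _ _) Hv (mkposreal eps Heps)) as [e He].
      exists e. intros k Hk Hke.
      specialize (He (t + k)).
      assert (Hb : ball t e (t + k)).
      { change (Rabs (t + k - t) < e). now replace (t + k - t) with k by ring. }
      specialize (He Hb ltac:(lra)).
      change (Rabs ((w x (t + k) - w x t) / (t + k - t) - v) < eps) in He.
      now replace (t + k - t) with k in He by ring. }
  intros x Hx. split; [ auto | split ].
  - apply derive_le_slope with (w x) t.
    + apply Derive_correct. auto.
    + intros e He. set (d := Rmin e (delta - Rabs t) / 2).
      assert (Hm : 0 < Rmin e (delta - Rabs t)) by (apply Rmin_pos; lra).
      pose proof (Rmin_l e (delta - Rabs t)). pose proof (Rmin_r e (delta - Rabs t)).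
      exists (t + d). assert (Hd : Rabs (t + d - t) = d).
      { replace (t + d - t) with d by ring. apply Rabs_pos_eq. unfold d. lra. }
      split; [ unfold d; lra | ]. split; [ rewrite Hd; unfold d; lra | ].
      apply HL; auto. apply Hnear. rewrite Hd. unfold d. lra.
  (* The derivative of this combination is computed twice: it is 0 by the quadratic estimate, and it
     is given by the rules of differentiation. *)
  - assert (H0 : is_derive
      (fun s => w (phi x) s - a x * w x s - b x * s) t 0).
    { apply is_derive_quadratic with C (delta - Rabs t); [ lra | ].
      intros s Hs. specialize (HC x s Hx (Hnear s Hs)).
      match goal with |- Rabs ?e <= _ => replace e with
        (w (phi x) s - w (phi x) t - a x * (w x s - w x t) - b x * (s - t))
        by ring end. easy. }
    assert (H1 : is_derive
      (fun s => w (phi x) s - a x * w x s - b x * s) t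
      (Derive (w (phi x)) t - a x * Derive (w x) t - b x)).
    { auto_derive; [ now repeat split; auto | ].
      change (fun s => w x s) with (w x).
      change (fun s => w (phi x) s) with (w (phi x)). ring. }
    apply is_derive_unique in H0. apply is_derive_unique in H1. lra.
Qed.

(** * Families that are C^k+Lip uniformly in a parameter *)

Definition uniform_bounded {X : Type} (D : X -> Prop) (delta : R)
    (w : X -> R -> R) : Prop :=
  exists M, 0 <= M /\
    forall x t, D x -> Rabs t < delta -> Rabs (w x t) <= M.

Definition uniform_lipschitz {X : Type} (D : X -> Prop) (delta : R)
    (w : X -> R -> R) : Prop :=
  exists L, 0 <= L /\
    forall x s t, D x -> Rabs s < delta -> Rabs t < delta ->
      Rabs (w x s - w x t) <= L * Rabs (s - t).

(** The bounds do not depend on the point of [D]. The recursion strips one derivative at a time, as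
    the inductions below do, and the parameter interval is open so that two-sided derivatives are
    determined by the values on it. *)
Fixpoint uniform_CkLip {X : Type} (k : nat) (D : X -> Prop) (delta : R)
    (w : X -> R -> R) : Prop :=
  uniform_bounded D delta w /\
  match k with
  | O => uniform_lipschitz D delta w
  | S k' => (forall x t, D x -> Rabs t < delta -> ex_derive (w x) t) /\
            uniform_CkLip k' D delta (fun x => Derive (w x))
  end.

Lemma locally_abs_lt (t delta : R) :
  Rabs t < delta -> locally t (fun s => Rabs s < delta).
Proof.
  intros Ht. assert (H : 0 < delta - Rabs t) by lra.
  exists (mkposreal _ H). intros s Hs.
  change (Rabs (s - t) < delta - Rabs t) in Hs.
  pose proof (Rabs_triang_inv s t). lra.
Qed.

Lemma uniform_CkLip_bounded {X : Type} k (D : X -> Prop) delta w :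
  uniform_CkLip k D delta w -> uniform_bounded D delta w.
Proof. destruct k; now intros [H _]. Qed.

Lemma uniform_CkLip_ext {X : Type} k (D : X -> Prop) delta w z :
  (forall x t, D x -> Rabs t < delta -> w x t = z x t) ->
  uniform_CkLip k D delta w -> uniform_CkLip k D delta z.
Proof.
  revert w z. induction k as [ | k IH]; intros w z Hwz [HM Hw].
  - split.
    + destruct HM as (M & HM0 & HM). exists M. split; [ easy | ].
      intros x t Hx Ht. rewrite <- Hwz by easy. auto.
    + destruct Hw as (L & HL0 & HL). exists L. split; [ easy | ].
      intros x s t Hx Hs Ht. rewrite <- !Hwz by easy. auto.
  - destruct Hw as [Hex Hw].
    assert (Hloc : forall x t, D x -> Rabs t < delta ->
      locally t (fun s => w x s = z x s)).
    { intros x t Hx Ht. generalize (locally_abs_lt t delta Ht).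
      apply filter_imp. auto. }
    split; [ | split ].
    + destruct HM as (M & HM0 & HM). exists M. split; [ easy | ].
      intros x t Hx Ht. rewrite <- Hwz by easy. auto.
    + intros x t Hx Ht. apply ex_derive_ext_loc with (w x); auto.
    + apply IH with (2 := Hw). intros x t Hx Ht. apply Derive_ext_loc. auto.
Qed.

Lemma uniform_CkLip_S {X : Type} k (D : X -> Prop) delta w dw :
  uniform_bounded D delta w ->
  (forall x t, D x -> Rabs t < delta -> is_derive (w x) t (dw x t)) ->
  uniform_CkLip k D delta dw -> uniform_CkLip (S k) D delta w.
Proof.
  intros HM Hd Hdw. split; [ easy | split ].
  - intros x t Hx Ht. eexists. now apply Hd.
  - apply uniform_CkLip_ext with (2 := Hdw). intros x t Hx Ht.
    symmetry. apply is_derive_unique. auto.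
Qed.

Lemma uniform_bounded_derive_lipschitz {X : Type} (D : X -> Prop) delta w :
  (forall x t, D x -> Rabs t < delta -> ex_derive (w x) t) ->
  uniform_bounded D delta (fun x => Derive (w x)) ->
  uniform_lipschitz D delta w.
Proof.
  intros Hex (M & HM0 & HM). exists M. split; [ easy | ].
  intros x s t Hx Hs Ht.
  destruct (mean_value (w x) (Derive (w x)) t s) as (z & Hz & ->).
  - intros z Hz. apply Derive_correct, Hex; [ easy | ].
    now apply between_abs with t s.
  - rewrite Rabs_mult. apply Rmult_le_compat_r; [ apply Rabs_pos | ].
    apply HM; [ easy | ]. now apply between_abs with t s.
Qed.

(** For [k = 0] the bound on the derivative is a Lipschitz constant by the mean value theorem;
    otherwise the claim passes to the derivative. *)
Lemma uniform_CkLip_pred {X : Type} k (D : X -> Prop) delta w :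
  uniform_CkLip (S k) D delta w -> uniform_CkLip k D delta w.
Proof.
  revert w. induction k as [ | k IH]; intros w (HM & Hex & Hw).
  - split; [ easy | ]. apply uniform_bounded_derive_lipschitz; [ easy | ].
    now apply uniform_CkLip_bounded in Hw.
  - split; [ easy | split; [ easy | auto ] ].
Qed.

Lemma uniform_CkLip_le {X : Type} j k (D : X -> Prop) delta w :
  (j <= k)%nat -> uniform_CkLip k D delta w -> uniform_CkLip j D delta w.
Proof.
  induction 1 as [ | k _ IH]; [ easy | ].
  intros H. now apply IH, uniform_CkLip_pred.
Qed.

Lemma uniform_CkLip_lipschitz {X : Type} k (D : X -> Prop) delta w :
  uniform_CkLip k D delta w -> uniform_lipschitz D delta w.
Proof. intros H. now apply (uniform_CkLip_le 0 k) in H as [_ H]; [ | lia ]. Qed.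

(** The mean value theorem evaluates the derivative at a point no farther from [t] than [s], and the
    derivative is Lipschitz. *)
Lemma uniform_C1Lip_quadratic {X : Type} k (D : X -> Prop) delta w :
  uniform_CkLip (S k) D delta w ->
  exists C, 0 <= C /\ forall x s t, D x -> Rabs s < delta -> Rabs t < delta ->
    Rabs (w x s - w x t - Derive (w x) t * (s - t)) <= C * Rabs (s - t) ^ 2.
Proof.
  intros (_ & Hex & Hw). apply uniform_CkLip_lipschitz in Hw.
  destruct Hw as (C & HC0 & HC). exists C. split; [ easy | ].
  intros x s t Hx Hs Ht.
  destruct (mean_value (w x) (Derive (w x)) t s) as (z & Hz & ->).
  - intros z Hz. apply Derive_correct, Hex; [ easy | ].
    now apply between_abs with t s.
  - replace (Derive (w x) z * (s - t) - Derive (w x) t * (s - t))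
      with ((Derive (w x) z - Derive (w x) t) * (s - t)) by ring.
    rewrite Rabs_mult. replace (C * Rabs (s - t) ^ 2)
      with (C * Rabs (s - t) * Rabs (s - t)) by ring.
    apply Rmult_le_compat_r; [ apply Rabs_pos | ].
    apply Rle_trans with (C * Rabs (z - t)).
    + apply HC; auto. now apply between_abs with t s.
    + apply Rmult_le_compat_l; [ easy | ]. now apply between_dist.
Qed.

Lemma uniform_bounded_plus {X : Type} (D : X -> Prop) delta w z :
  uniform_bounded D delta w -> uniform_bounded D delta z ->
  uniform_bounded D delta (fun x t => w x t + z x t).
Proof.
  intros (M & HM0 & HM) (N & HN0 & HN). exists (M + N). split; [ lra | ].
  intros x t Hx Ht. eapply Rle_trans; [ apply Rabs_triang | ].
  specialize (HM x t Hx Ht). specialize (HN x t Hx Ht). lra.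
Qed.

Lemma uniform_bounded_mult {X : Type} (D : X -> Prop) delta w z :
  uniform_bounded D delta w -> uniform_bounded D delta z ->
  uniform_bounded D delta (fun x t => w x t * z x t).
Proof.
  intros (M & HM0 & HM) (N & HN0 & HN). exists (M * N). split; [ nra | ].
  intros x t Hx Ht. rewrite Rabs_mult.
  apply Rmult_le_compat; auto using Rabs_pos.
Qed.

Lemma uniform_CkLip_plus {X : Type} k (D : X -> Prop) delta w z :
  uniform_CkLip k D delta w -> uniform_CkLip k D delta z ->
  uniform_CkLip k D delta (fun x t => w x t + z x t).
Proof.
  revert w z. induction k as [ | k IH]; intros w z [HM Hw] [HN Hz].
  - split; [ now apply uniform_bounded_plus | ].
    destruct Hw as (L & HL0 & HL), Hz as (K & HK0 & HK).
    exists (L + K). split; [ lra | ]. intros x s t Hx Hs Ht.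
    replace (w x s + z x s - (w x t + z x t))
      with (w x s - w x t + (z x s - z x t)) by ring.
    eapply Rle_trans; [ apply Rabs_triang | ].
    specialize (HL x s t Hx Hs Ht). specialize (HK x s t Hx Hs Ht). lra.
  - destruct Hw as [Hew Hw], Hz as [Hez Hz].
    apply uniform_CkLip_S with (fun x t => Derive (w x) t + Derive (z x) t).
    + now apply uniform_bounded_plus.
    + intros x t Hx Ht. apply (is_derive_plus (w x) (z x));
        apply Derive_correct; auto.
    + now apply IH.
Qed.

(** Leibniz rule: each term pairs a derivative with an undifferentiated factor, and the latter is
    first lowered to class [k]. *)
Lemma uniform_CkLip_mult {X : Type} k (D : X -> Prop) delta w z :
  uniform_CkLip k D delta w -> uniform_CkLip k D delta z ->
  uniform_CkLip k D delta (fun x t => w x t * z x t).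
Proof.
  revert w z. induction k as [ | k IH]; intros w z Hw0 Hz0;
    pose proof Hw0 as [HM Hw]; pose proof Hz0 as [HN Hz].
  - split; [ now apply uniform_bounded_mult | ].
    destruct HM as (M & HM0 & HM), HN as (N & HN0 & HN).
    destruct Hw as (L & HL0 & HL), Hz as (K & HK0 & HK).
    exists (L * N + M * K). split; [ nra | ]. intros x s t Hx Hs Ht.
    replace (w x s * z x s - w x t * z x t)
      with ((w x s - w x t) * z x s + w x t * (z x s - z x t)) by ring.
    eapply Rle_trans; [ apply Rabs_triang | ]. rewrite !Rabs_mult.
    replace ((L * N + M * K) * Rabs (s - t))
      with (L * Rabs (s - t) * N + M * (K * Rabs (s - t))) by ring.
    apply Rplus_le_compat; apply Rmult_le_compat; auto using Rabs_pos.
  - destruct Hw as [Hew Hw], Hz as [Hez Hz].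
    apply uniform_CkLip_S
      with (fun x t => Derive (w x) t * z x t + w x t * Derive (z x) t).
    + now apply uniform_bounded_mult.
    + intros x t Hx Ht.
      apply (is_derive_mult (w x) (z x));
        [ apply Derive_correct; auto | apply Derive_correct; auto | ].
      intros; apply Rmult_comm.
    + apply uniform_CkLip_plus; apply IH; auto using uniform_CkLip_pred.
Qed.

(** * Bounded solutions of linear cohomological equations *)

(** Differentiating v(phi x) = a v + p in the parameter shows that v' solves the same equation with
    p replaced by a' v + p'. Induction on [k] therefore reduces to the Lipschitz case, where
    increments of [v] satisfy an expanding recursion. *)
Lemma uniform_CkLip_cohomological {X : Type} k (D : X -> Prop) (phi : X -> X)
    delta lam a p v :
  (forall x, D x -> D (phi x)) -> 1 < lam ->
  (forall x t, D x -> Rabs t < delta -> lam <= Rabs (a x t)) ->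
  uniform_CkLip k D delta a -> uniform_CkLip k D delta p ->
  uniform_bounded D delta v ->
  (forall x t, D x -> Rabs t < delta -> v (phi x) t = a x t * v x t + p x t) ->
  uniform_CkLip k D delta v.
Proof.
  (* [p] and [v] vary in the induction, while the multiplier [a] stays the same. *)
  intros Hphi Hlam Ha. revert p v.
  induction k as [ | k IH]; intros p v Hak Hpk Hv Hrec.
  - split; [ easy | ]. destruct Hv as (B & HB0 & HB).
    destruct Hak as [_ (L & HL0 & HL)], Hpk as [_ (K & HK0 & HK)].
    exists ((L * B + K) / (lam - 1)). split.
    { apply Rmult_le_pos; [ nra | ].
      left. apply Rinv_0_lt_compat. lra. }
    intros x s t Hx Hs Ht.
    replace ((L * B + K) / (lam - 1) * Rabs (s - t))
      with ((L * B + K) * Rabs (s - t) / (lam - 1)) by (field; lra).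
    revert x Hx. apply (expanding_sup D phi
      (fun x => Rabs (v x s - v x t)) lam _ (B + B)); auto.
    + intros x Hx. unfold Rminus. eapply Rle_trans; [ apply Rabs_triang | ].
      rewrite Rabs_Ropp. apply Rplus_le_compat; auto.
    + intros x Hx. rewrite !Hrec by easy.
      apply Rle_trans with (Rabs (a x s * (v x s - v x t))).
      { rewrite Rabs_mult. apply Rmult_le_compat_r; [ apply Rabs_pos | auto ]. }
      replace (a x s * (v x s - v x t)) with
        (a x s * v x s + p x s - (a x t * v x t + p x t)
         + - ((a x s - a x t) * v x t + (p x s - p x t))) by ring.
      eapply Rle_trans; [ apply Rabs_triang | ]. apply Rplus_le_compat_l.
      rewrite Rabs_Ropp. eapply Rle_trans; [ apply Rabs_triang | ].
      rewrite Rabs_mult, Rmult_plus_distr_r.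
      apply Rplus_le_compat; [ | auto ].
      replace (L * B * Rabs (s - t)) with (L * Rabs (s - t) * B) by ring.
      apply Rmult_le_compat; auto using Rabs_pos.
  (* Class [k] comes first: it supplies the Lipschitz constant of [v] that bounds the difference
     quotients a priori. *)
  - assert (Hvk : uniform_CkLip k D delta v).
    { apply IH with p; auto using uniform_CkLip_pred. }
    destruct (uniform_CkLip_lipschitz k D delta v Hvk) as (Lv & HLv0 & HLv).
    destruct (uniform_CkLip_lipschitz _ D delta a Hak) as (La & HLa0 & HLa).
    destruct (uniform_C1Lip_quadratic k D delta a Hak) as (Ca & HCa0 & HCa).
    destruct (uniform_C1Lip_quadratic k D delta p Hpk) as (Cp & HCp0 & HCp).
    pose proof Hv as (B & HB0 & HB).
    assert (Hd : forall t, Rabs t < delta -> forall x, D x ->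
      ex_derive (v x) t /\ Rabs (Derive (v x) t) <= Lv /\
      Derive (v (phi x)) t = a x t * Derive (v x) t
         + (Derive (a x) t * v x t + Derive (p x) t)).
    { intros t Ht. apply (expanding_differentiable D phi v (fun x => a x t)
        (fun x => Derive (a x) t * v x t + Derive (p x) t)
        lam (La * Lv + (Ca * B + Cp)) Lv delta t); auto.
      intros x s Hx Hs. rewrite !Hrec by easy.
      (* The error is a product of two first-order increments plus the second-order remainders of
         [a] and [p]. *)
      match goal with |- Rabs ?e <= _ => replace e with
        ((a x s - a x t) * (v x s - v x t)
         + ((a x s - a x t - Derive (a x) t * (s - t)) * v x t
            + (p x s - p x t - Derive (p x) t * (s - t)))) by ring end.
      replace ((La * Lv + (Ca * B + Cp)) * Rabs (s - t) ^ 2) with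
        (La * Rabs (s - t) * (Lv * Rabs (s - t)) +
          (Ca * Rabs (s - t) ^ 2 * B + Cp * Rabs (s - t) ^ 2)) by ring.
      eapply Rle_trans; [ apply Rabs_triang | ]. apply Rplus_le_compat.
      { rewrite Rabs_mult. apply Rmult_le_compat; auto using Rabs_pos. }
      eapply Rle_trans; [ apply Rabs_triang | ].
      apply Rplus_le_compat; [ | auto ].
      rewrite Rabs_mult. apply Rmult_le_compat; auto using Rabs_pos. }
    split; [ easy | split ].
    + intros x t Hx Ht. now apply Hd.
    + pose proof Hak as (_ & _ & Hdak). pose proof Hpk as (_ & _ & Hdpk).
      apply IH with (fun x t => Derive (a x) t * v x t + Derive (p x) t).
      * now apply uniform_CkLip_pred.
      * apply uniform_CkLip_plus; [ | easy ]. now apply uniform_CkLip_mult.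
      * exists Lv. split; [ easy | ]. intros x t Hx Ht. now apply Hd.
      * intros x t Hx Ht. now apply Hd.
Qed.

(** * Functions of two variables on a box *)

(* [P d p] reads "[P] holds at [p] with margin [d]". *)
Lemma compact_uniform (P : R -> R * R -> Prop) (a b a' b' : R) :
  (forall d e p, 0 < d <= e -> P e p -> P d p) ->
  (forall u v, a <= u <= b -> a' <= v <= b' ->
     exists d, 0 < d /\ forall x y, a <= x <= b ->
       Rabs (x - u) < d -> Rabs (y - v) < d -> P d (x, y)) ->
  exists d, 0 < d /\
    forall x y, a <= x <= b -> a' <= y <= b' -> P d (x, y).
Proof.
  intros Hmono Hloc.
  set (Q := fun u v (d : posreal) => forall x y, a <= x <= b ->
       Rabs (x - u) < d -> Rabs (y - v) < d -> P d (x, y)).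
  (* A local margin is chosen at each point by [epsilon]; the default 1 is returned where no margin
     exists, which does not happen on the rectangle. *)
  destruct (compactness_value_2d a b a' b'
    (fun u v => epsilon (inhabits (mkposreal 1 Rlt_0_1)) (Q u v))) as [d Hd].
  exists d. split; [ apply cond_pos | ]. intros x y Hx Hy.
  (* The covering statement is doubly negated, so the goal is proved by contradiction. *)
  apply NNPP. intros Hn. apply (Hd x y Hx Hy).
  intros (u & v & Hu & Hv & Hxu & Hyv & Hle). apply Hn.
  eapply Hmono; [ split; [ apply cond_pos | exact Hle ] | ].
  assert (HQ : exists e, Q u v e).
  { destruct (Hloc u v Hu Hv) as (e & He & HP). now exists (mkposreal e He). }
  now apply (epsilon_spec (inhabits (mkposreal 1 Rlt_0_1)) (Q u v) HQ).
Qed.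

(** Closed in the parameter as well, hence compact, whereas the families are taken over the open
    interval [Rabs t < delta]. *)
Definition box (lo hi delta : R) : R * R -> Prop :=
  fun p => lo <= fst p <= hi /\ Rabs (snd p) <= delta.

(** The bound is encoded as the inverse of a margin, so that shrinking the margin weakens the claim
    as [compact_uniform] demands. *)
Lemma box_bounded (lo hi delta : R) (F : R * R -> R) :
  (forall p, box lo hi delta p -> continuous F p) ->
  exists M, 0 <= M /\ forall p, box lo hi delta p -> Rabs (F p) <= M.
Proof.
  intros Hc.
  destruct (compact_uniform (fun d p => Rabs (F p) <= / d) lo hi (- delta) delta)
    as (d & Hd & HF).
  - intros d e p Hde HF. apply Rle_trans with (1 := HF).
    apply Rinv_le_contravar; lra.
  - intros u v Hu Hv.
    assert (Hb : box lo hi delta (u, v)) by (split; [ easy | now apply Rabs_le ]).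
    specialize (Hc _ Hb).
    destruct (proj1 (filterlim_locally _ _) Hc (mkposreal 1 Rlt_0_1)) as [e He].
    set (M := Rabs (F (u, v)) + 1).
    assert (HM : 0 < M) by (pose proof (Rabs_pos (F (u, v))); unfold M; lra).
    exists (Rmin e (/ M)). split.
    { apply Rmin_pos; [ apply cond_pos | now apply Rinv_0_lt_compat ]. }
    intros x y _ Hx Hy. pose proof (Rmin_l e (/ M)). pose proof (Rmin_r e (/ M)).
    apply Rle_trans with M.
    + assert (Hxy : ball (u, v) e (x, y)).
      { split; [ change (Rabs (x - u) < e) | change (Rabs (y - v) < e) ]; lra. }
      specialize (He _ Hxy). change (Rabs (F (x, y) - F (u, v)) < 1) in He.
      pose proof (Rabs_triang_inv (F (x, y)) (F (u, v))). unfold M. lra.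
    + rewrite <- (Rinv_inv M) at 1. apply Rinv_le_contravar; [ | easy ].
      apply Rmin_pos; [ apply cond_pos | now apply Rinv_0_lt_compat ].
  - exists (/ d). split; [ left; now apply Rinv_0_lt_compat | ].
    intros [x y] [Hx Hy]. apply HF; [ easy | ].
    now apply Rabs_le_between.
Qed.

Lemma box_segment1 lo hi delta x y t z :
  box lo hi delta (x, t) -> box lo hi delta (y, t) ->
  Rmin x y <= z <= Rmax x y -> box lo hi delta (z, t).
Proof.
  unfold box, Rmin, Rmax; simpl.
  destruct (Rle_dec x y); intros [Hx Ht] [Hy _] Hz; split; lra.
Qed.

Lemma box_segment2 lo hi delta x s t z :
  box lo hi delta (x, s) -> box lo hi delta (x, t) ->
  Rmin s t <= z <= Rmax s t -> box lo hi delta (x, z).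
Proof.
  unfold box; simpl. intros [Hx Hs] [_ Ht] Hz; split; [ easy | ].
  apply Rabs_le_between in Hs; apply Rabs_le_between in Ht.
  apply Rabs_le. unfold Rmin, Rmax in Hz. destruct (Rle_dec s t); lra.
Qed.

Lemma Ck2_is_derive1 k W H x t :
  Ck2 (S k) W H -> W (x, t) ->
  is_derive (fun y => H (y, t)) x (partial1 H (x, t)).
Proof. intros (_ & He & _) Hp. apply Derive_correct. now apply (He (x, t)). Qed.

Lemma Ck2_is_derive2 k W H x t :
  Ck2 (S k) W H -> W (x, t) ->
  is_derive (fun s => H (x, s)) t (partial2 H (x, t)).
Proof. intros (_ & He & _) Hp. apply Derive_correct. now apply (He (x, t)). Qed.

Lemma Ck2_continuous k W H p : Ck2 k W H -> W p -> continuous H p.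
Proof. destruct k; intros [Hc _]; auto. Qed.

Lemma Ck2_pred k W H : Ck2 (S k) W H -> Ck2 k W H.
Proof.
  revert H. induction k as [ | k IH]; intros H (Hc & He & H1 & H2).
  - now split.
  - split; [ easy | ]. split; [ easy | ]. split; now apply IH.
Qed.

(** Two one-variable mean value theorems along the path from (x, t) to (x, s) to (y, s), whose
    corner lies in the box because the box is a product. *)
Lemma box_mean_value k W H lo hi delta x y s t :
  Ck2 (S k) W H -> (forall p, box lo hi delta p -> W p) ->
  box lo hi delta (x, t) -> box lo hi delta (y, s) ->
  exists xi tau, Rmin x y <= xi <= Rmax x y /\ Rmin t s <= tau <= Rmax t s /\
    box lo hi delta (xi, s) /\ box lo hi delta (x, tau) /\
    H (y, s) - H (x, t)
      = partial1 H (xi, s) * (y - x) + partial2 H (x, tau) * (s - t).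
Proof.
  intros HC HW Hxt Hys.
  assert (Hxs : box lo hi delta (x, s)) by (split; [ apply Hxt | apply Hys ]).
  destruct (mean_value (fun z => H (z, s)) (fun z => partial1 H (z, s)) x y)
    as (xi & Hxi & E1).
  { intros z Hz. apply Ck2_is_derive1 with k W; [ easy | ].
    apply HW. now apply box_segment1 with x y. }
  destruct (mean_value (fun z => H (x, z)) (fun z => partial2 H (x, z)) t s)
    as (tau & Htau & E2).
  { intros z Hz. apply Ck2_is_derive2 with k W; [ easy | ].
    apply HW. now apply box_segment2 with t s. }
  exists xi, tau. split; [ easy | ]. split; [ easy | ].
  split; [ now apply box_segment1 with x y | ].
  split; [ now apply box_segment2 with t s | ].
  rewrite <- E1, <- E2. ring.
Qed.

Lemma box_lipschitz k W H lo hi delta :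
  Ck2 (S k) W H -> (forall p, box lo hi delta p -> W p) ->
  exists L, 0 <= L /\ forall x y s t,
    box lo hi delta (x, t) -> box lo hi delta (y, s) ->
    Rabs (H (y, s) - H (x, t)) <= L * (Rabs (y - x) + Rabs (s - t)).
Proof.
  intros HC HW. pose proof HC as (_ & _ & HC1 & HC2).
  destruct (box_bounded lo hi delta (partial1 H)) as (M & HM0 & HM).
  { intros p Hp. apply Ck2_continuous with k W; auto. }
  destruct (box_bounded lo hi delta (partial2 H)) as (N & HN0 & HN).
  { intros p Hp. apply Ck2_continuous with k W; auto. }
  exists (M + N). split; [ lra | ]. intros x y s t Hxt Hys.
  destruct (box_mean_value k W H lo hi delta x y s t HC HW Hxt Hys)
    as (xi & tau & _ & _ & H1 & H2 & ->).
  eapply Rle_trans; [ apply Rabs_triang | ]. rewrite !Rabs_mult.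
  specialize (HM _ H1). specialize (HN _ H2).
  pose proof (Rabs_pos (y - x)). pose proof (Rabs_pos (s - t)). nra.
Qed.

(** Both intermediate points of [box_mean_value] lie within |y - x| + |s - t| of (x, t), and the
    partial derivatives are Lipschitz on the box. *)
Lemma box_taylor k W H lo hi delta :
  Ck2 (S (S k)) W H -> (forall p, box lo hi delta p -> W p) ->
  exists C, 0 <= C /\ forall x y s t,
    box lo hi delta (x, t) -> box lo hi delta (y, s) ->
    Rabs (H (y, s) - H (x, t) - partial1 H (x, t) * (y - x)
            - partial2 H (x, t) * (s - t))
      <= C * (Rabs (y - x) + Rabs (s - t)) ^ 2.
Proof.
  intros HC HW. pose proof HC as (_ & _ & HC1 & HC2).
  destruct (box_lipschitz _ _ _ lo hi delta HC1 HW) as (M & HM0 & HM).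
  destruct (box_lipschitz _ _ _ lo hi delta HC2 HW) as (N & HN0 & HN).
  exists (M + N). split; [ lra | ]. intros x y s t Hxt Hys.
  destruct (box_mean_value _ W H lo hi delta x y s t HC HW Hxt Hys)
    as (xi & tau & Hxi & Htau & H1 & H2 & E).
  specialize (HM _ _ _ _ Hxt H1). specialize (HN _ _ _ _ Hxt H2).
  replace (x - x) with 0 in HN by ring. rewrite Rabs_R0 in HN.
  apply between_dist in Hxi. apply between_dist in Htau.
  rewrite E.
  match goal with |- Rabs ?e <= _ => replace e with
    ((partial1 H (xi, s) - partial1 H (x, t)) * (y - x)
     + (partial2 H (x, tau) - partial2 H (x, t)) * (s - t)) by ring end.
  eapply Rle_trans; [ apply Rabs_triang | ]. rewrite !Rabs_mult.
  pose proof (Rabs_pos (y - x)). pose proof (Rabs_pos (s - t)).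
  set (A := Rabs (y - x)) in *. set (B := Rabs (s - t)) in *.
  assert (HMx : Rabs (partial1 H (xi, s) - partial1 H (x, t)) <= M * (A + B)).
  { apply Rle_trans with (1 := HM). apply Rmult_le_compat_l; lra. }
  assert (HNt : Rabs (partial2 H (x, tau) - partial2 H (x, t)) <= N * (A + B)).
  { apply Rle_trans with (1 := HN). apply Rmult_le_compat_l; lra. }
  replace ((M + N) * (A + B) ^ 2)
    with (M * (A + B) * (A + B) + N * (A + B) * (A + B)) by ring.
  apply Rplus_le_compat; apply Rmult_le_compat; try apply Rabs_pos; lra.
Qed.

(* Booleans index the two branches of the map. *)
Lemma bool_uniform (P : bool -> R -> Prop) :
  (forall i M N, M <= N -> P i M -> P i N) ->
  (forall i, exists M, 0 <= M /\ P i M) ->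
  exists M, 0 <= M /\ forall i, P i M.
Proof.
  intros Hmono HP. destruct (HP true) as (M & HM0 & HM), (HP false) as (N & HN0 & HN).
  exists (Rmax M N). split.
  - apply Rle_trans with (1 := HM0). apply Rmax_l.
  - intros [ | ].
    + apply Hmono with (2 := HM). apply Rmax_l.
    + apply Hmono with (2 := HN). apply Rmax_r.
Qed.

(** * Composition of a family with functions of two variables *)

Lemma uniform_bounded_composition {X : Type} (H : bool -> R * R -> R)
    (lo hi : bool -> R) delta (D : X -> Prop) (sg : X -> bool) (u : X -> R -> R) :
  (forall i p, box (lo i) (hi i) delta p -> continuous (H i) p) ->
  (forall x t, D x -> Rabs t < delta -> lo (sg x) <= u x t <= hi (sg x)) ->
  uniform_bounded D delta (fun x t => H (sg x) (u x t, t)).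
Proof.
  intros Hc Hu.
  destruct (bool_uniform (fun i M => forall p, box (lo i) (hi i) delta p ->
    Rabs (H i p) <= M)) as (M & HM0 & HM).
  - intros i M N HMN HM p Hp. specialize (HM p Hp). lra.
  - intros i. apply box_bounded. auto.
  - exists M. split; [ easy | ]. intros x t Hx Ht. apply HM.
    split; simpl; [ auto | lra ].
Qed.

(** Since u is Lipschitz in the parameter, the space increment in [box_taylor] is at most L |s - t|,
    whence the constant C (L + 1)^2. The branch [sg x] does not change with the parameter, so a
    single [H] is expanded. *)
Lemma composition_taylor {X : Type} k (W : bool -> R * R -> Prop)
    (H : bool -> R * R -> R) (lo hi : bool -> R) delta
    (D : X -> Prop) (sg : X -> bool) (u : X -> R -> R) :
  (forall i, Ck2 (S (S k)) (W i) (H i)) ->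
  (forall i p, box (lo i) (hi i) delta p -> W i p) ->
  (forall x t, D x -> Rabs t < delta -> lo (sg x) <= u x t <= hi (sg x)) ->
  uniform_lipschitz D delta u ->
  exists C, 0 <= C /\ forall x s t, D x -> Rabs s < delta -> Rabs t < delta ->
    Rabs (H (sg x) (u x s, s) - H (sg x) (u x t, t)
          - partial1 (H (sg x)) (u x t, t) * (u x s - u x t)
          - partial2 (H (sg x)) (u x t, t) * (s - t)) <= C * Rabs (s - t) ^ 2.
Proof.
  intros HC HW Hu (L & HL0 & HL).
  destruct (bool_uniform (fun i C => forall x y s t,
    box (lo i) (hi i) delta (x, t) -> box (lo i) (hi i) delta (y, s) ->
    Rabs (H i (y, s) - H i (x, t) - partial1 (H i) (x, t) * (y - x)
            - partial2 (H i) (x, t) * (s - t))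
      <= C * (Rabs (y - x) + Rabs (s - t)) ^ 2)) as (C & HC0 & HT).
  - intros i M N HMN HM x y s t H1 H2. apply Rle_trans with (1 := HM x y s t H1 H2).
    apply Rmult_le_compat_r; [ apply pow2_ge_0 | easy ].
  - intros i. apply box_taylor with k (W i); auto.
  - exists (C * (L + 1) ^ 2).
    split; [ apply Rmult_le_pos; [ easy | apply pow2_ge_0 ] | ].
    intros x s t Hx Hs Ht.
    apply Rle_trans with (1 := HT (sg x) (u x t) (u x s) s t
      ltac:(split; simpl; [ auto | lra ]) ltac:(split; simpl; [ auto | lra ])).
    rewrite Rmult_assoc, <- Rpow_mult_distr. apply Rmult_le_compat_l; [ easy | ].
    apply pow_incr. specialize (HL x s t Hx Hs Ht).
    pose proof (Rabs_pos (u x s - u x t)). pose proof (Rabs_pos (s - t)). lra.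
Qed.

(** By the chain rule the derivative is a sum and product of u' and compositions with the partial
    derivatives of [H], to which the induction applies. In the base case a C^1 bound on [H] yields a
    Lipschitz bound, hence the shift [S k]. *)
Lemma uniform_CkLip_composition {X : Type} k (W : bool -> R * R -> Prop)
    (H : bool -> R * R -> R) (lo hi : bool -> R) delta
    (D : X -> Prop) (sg : X -> bool) (u : X -> R -> R) :
  (forall i, Ck2 (S k) (W i) (H i)) ->
  (forall i p, box (lo i) (hi i) delta p -> W i p) ->
  (forall x t, D x -> Rabs t < delta -> lo (sg x) <= u x t <= hi (sg x)) ->
  uniform_CkLip k D delta u ->
  uniform_CkLip k D delta (fun x t => H (sg x) (u x t, t)).
Proof.
  intros HC HW Hu. revert H HC. induction k as [ | k IH]; intros H HC Huk;
  assert (Hbd : uniform_bounded D delta (fun x t => H (sg x) (u x t, t)));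
  try (apply uniform_bounded_composition with lo hi; try easy; intros i p Hp;
       apply Ck2_continuous with (1 := HC i); auto).
  - split; [ easy | ].
    destruct (uniform_CkLip_lipschitz _ _ _ _ Huk) as (L & HL0 & HL).
    destruct (bool_uniform (fun i K => forall x y s t,
      box (lo i) (hi i) delta (x, t) -> box (lo i) (hi i) delta (y, s) ->
      Rabs (H i (y, s) - H i (x, t)) <= K * (Rabs (y - x) + Rabs (s - t))))
      as (K & HK0 & HK).
    + intros i M N HMN HM x y s t H1 H2.
      apply Rle_trans with (1 := HM x y s t H1 H2).
      apply Rmult_le_compat_r; [ | easy ].
      pose proof (Rabs_pos (y - x)). pose proof (Rabs_pos (s - t)). lra.
    + intros i. apply box_lipschitz with 0%nat (W i); auto.
    + exists (K * (L + 1)). split; [ nra | ]. intros x s t Hx Hs Ht.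
      apply Rle_trans with (1 := HK (sg x) (u x t) (u x s) s t
        ltac:(split; simpl; [ auto | lra ]) ltac:(split; simpl; [ auto | lra ])).
      rewrite Rmult_assoc. apply Rmult_le_compat_l; [ easy | ].
      specialize (HL x s t Hx Hs Ht). lra.
  - pose proof (uniform_CkLip_pred _ _ _ _ Huk) as Huk'.
    pose proof Huk as (_ & Hex & Hdu).
    apply uniform_CkLip_S with (fun x t =>
      partial1 (H (sg x)) (u x t, t) * Derive (u x) t
      + partial2 (H (sg x)) (u x t, t)); [ easy | | ].
    + intros x t Hx Ht.
      destruct (composition_taylor k W H lo hi delta D sg u HC HW Hu
        (uniform_CkLip_lipschitz _ _ _ _ Huk)) as (C & HC0 & HT).
      set (A := partial1 (H (sg x)) (u x t, t)).
      set (B := partial2 (H (sg x)) (u x t, t)).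
      (* The chain rule is read off the Taylor estimate: the remainder has derivative 0 at [t], and
         the linear part is then added back. *)
      assert (Hr : is_derive (fun s : R => H (sg x) (u x s, s)
        - A * (u x s - u x t) - B * (s - t)) t 0).
      { apply is_derive_quadratic with C (delta - Rabs t); [ lra | ].
        intros s Hs.
        assert (Hsd : Rabs s < delta) by (pose proof (Rabs_triang_inv s t); lra).
        specialize (HT x s t Hx Hsd Ht). fold A B in HT.
        cbv beta. match goal with |- Rabs ?e <= _ => replace e with
          (H (sg x) (u x s, s) - H (sg x) (u x t, t)
            - A * (u x s - u x t) - B * (s - t)) by ring end. easy. }
      apply (is_derive_ext (fun s : R => (H (sg x) (u x s, s)
        - A * (u x s - u x t) - B * (s - t)) + (A * (u x s - u x t) + B * (s - t)))).
      { intros s. simpl. ring. }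
      replace (A * Derive (u x) t + B) with (0 + (A * Derive (u x) t + B)) by ring.
      apply (is_derive_plus (fun s : R => H (sg x) (u x s, s)
        - A * (u x s - u x t) - B * (s - t))
        (fun s : R => A * (u x s - u x t) + B * (s - t))); [ easy | ].
      auto_derive; [ now apply Hex | ].
      change (fun s => u x s) with (u x). ring.
    + apply uniform_CkLip_plus.
      * apply uniform_CkLip_mult; [ | easy ].
        apply (IH (fun i => partial1 (H i))); [ | easy ].
        intros i. apply HC.
      * apply (IH (fun i => partial2 (H i))); [ | easy ].
        intros i. apply HC.
Qed.

(** * Regularity of solutions of the conjugacy equation *)

(** For fixed x the values of u at two parameters lie in the same interval, so the mean value
    theorem applies to one [G] and gives lam |du_x| <= |du_{phi x}| + M |s - t|. Confinement to the
    intervals provides the a priori bound. *)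
Lemma uniform_lipschitz_conjugacy {X : Type} (W : bool -> R * R -> Prop)
    (G : bool -> R * R -> R) (lo hi : bool -> R) delta lam
    (D : X -> Prop) (sg : X -> bool) (phi : X -> X) (u : X -> R -> R) :
  (forall i, Ck2 1 (W i) (G i)) ->
  (forall i p, box (lo i) (hi i) delta p -> W i p) ->
  1 < lam ->
  (forall i p, box (lo i) (hi i) delta p -> lam <= Rabs (partial1 (G i) p)) ->
  (forall x, D x -> D (phi x)) ->
  (forall x t, D x -> Rabs t < delta -> lo (sg x) <= u x t <= hi (sg x)) ->
  (forall x t, D x -> Rabs t < delta -> u (phi x) t = G (sg x) (u x t, t)) ->
  uniform_CkLip 0 D delta u.
Proof.
  intros HC HW Hlam Hexp Hphi Hu Hrec.
  destruct (bool_uniform (fun i M => forall x, lo i <= x <= hi i -> Rabs x <= M))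
    as (B & HB0 & HB).
  { intros i M N HMN HM x Hx. specialize (HM x Hx). lra. }
  { intros i. exists (Rabs (lo i) + Rabs (hi i)).
    pose proof (Rabs_pos (lo i)). pose proof (Rabs_pos (hi i)).
    split; [ lra | ]. intros x Hx. pose proof (Rle_abs (hi i)).
    pose proof (Rle_abs (- lo i)). rewrite Rabs_Ropp in *. apply Rabs_le. lra. }
  split; [ exists B; split; [ easy | ]; intros x t Hx Ht; apply (HB (sg x)); auto | ].
  destruct (bool_uniform (fun i M => forall p, box (lo i) (hi i) delta p ->
    Rabs (partial2 (G i) p) <= M)) as (M & HM0 & HM).
  { intros i M N HMN HM p Hp; specialize (HM p Hp); lra. }
  { intros i; apply box_bounded; intros p Hp.
    apply Ck2_continuous with 0%nat (W i); auto. apply HC. }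
  exists (M / (lam - 1)). split.
  { apply Rmult_le_pos; [ easy | ]. left. apply Rinv_0_lt_compat. lra. }
  intros x s t Hx Hs Ht.
  replace (M / (lam - 1) * Rabs (s - t)) with (M * Rabs (s - t) / (lam - 1))
    by (field; lra).
  revert x Hx.
  apply (expanding_sup D phi (fun x => Rabs (u x s - u x t)) lam _ (B + B)); auto.
  - intros x Hx. unfold Rminus. eapply Rle_trans; [ apply Rabs_triang | ].
    rewrite Rabs_Ropp. apply Rplus_le_compat; apply (HB (sg x)); auto.
  - intros x Hx. rewrite !Hrec by easy.
    destruct (box_mean_value 0 (W (sg x)) (G (sg x)) (lo (sg x)) (hi (sg x)) delta
      (u x t) (u x s) s t) as (xi & tau & _ & _ & H1 & H2 & E); auto.
    { split; simpl; [ auto | lra ]. }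
    { split; simpl; [ auto | lra ]. }
    rewrite E. specialize (HM _ _ H2). specialize (Hexp _ _ H1).
    set (p1 := partial1 (G (sg x)) (xi, s)) in *.
    set (p2 := partial2 (G (sg x)) (u x t, tau)) in *.
    apply Rle_trans with (Rabs (p1 * (u x s - u x t))).
    { rewrite Rabs_mult. apply Rmult_le_compat_r; [ apply Rabs_pos | easy ]. }
    replace (p1 * (u x s - u x t))
      with (p1 * (u x s - u x t) + p2 * (s - t) + - (p2 * (s - t))) at 1 by ring.
    eapply Rle_trans; [ apply Rabs_triang | ]. apply Rplus_le_compat_l.
    rewrite Rabs_Ropp, Rabs_mult. apply Rmult_le_compat_r; [ apply Rabs_pos | easy ].
Qed.

(** Bootstrap: if u has class [k], so do the coefficients G_x(u, t) and G_t(u, t), hence so does the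
    bounded solution u' of the linearised equation, and u has class [S k]. *)
Lemma uniform_CkLip_conjugacy {X : Type} k (W : bool -> R * R -> Prop)
    (G : bool -> R * R -> R) (lo hi : bool -> R) delta lam
    (D : X -> Prop) (sg : X -> bool) (phi : X -> X) (u : X -> R -> R) :
  (forall i, Ck2 (S k) (W i) (G i)) ->
  (forall i p, box (lo i) (hi i) delta p -> W i p) ->
  1 < lam ->
  (forall i p, box (lo i) (hi i) delta p -> lam <= Rabs (partial1 (G i) p)) ->
  (forall x, D x -> D (phi x)) ->
  (forall x t, D x -> Rabs t < delta -> lo (sg x) <= u x t <= hi (sg x)) ->
  (forall x t, D x -> Rabs t < delta -> u (phi x) t = G (sg x) (u x t, t)) ->
  uniform_CkLip k D delta u.
Proof.
  intros HC HW Hlam Hexp Hphi Hu Hrec. induction k as [ | k IH].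
  { now apply uniform_lipschitz_conjugacy with W G lo hi lam sg phi. }
  assert (Huk : uniform_CkLip k D delta u) by (apply IH; intros i; now apply Ck2_pred).
  pose proof (uniform_CkLip_lipschitz _ _ _ _ Huk) as HL.
  destruct (composition_taylor k W G lo hi delta D sg u HC HW Hu HL)
    as (C & HC0 & HT).
  destruct HL as (L & HL0 & HL).
  assert (Hbox : forall x t, D x -> Rabs t < delta ->
            box (lo (sg x)) (hi (sg x)) delta (u x t, t)).
  { intros x t Hx Ht. split; simpl; [ auto | lra ]. }
  assert (Hd : forall t, Rabs t < delta -> forall x, D x ->
    ex_derive (u x) t /\ Rabs (Derive (u x) t) <= L /\
    Derive (u (phi x)) t = partial1 (G (sg x)) (u x t, t) * Derive (u x) t
       + partial2 (G (sg x)) (u x t, t)).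
  (* The Taylor estimate for [G] along u is precisely the approximate linear recursion required for
     differentiability. *)
  { intros t Ht. apply (expanding_differentiable D phi u
      (fun x => partial1 (G (sg x)) (u x t, t))
      (fun x => partial2 (G (sg x)) (u x t, t)) lam C L delta t); auto.
    intros x s Hx Hs. rewrite !Hrec by easy. auto. }
  split; [ now apply uniform_CkLip_bounded in Huk | split ].
  { intros x t Hx Ht. now apply Hd. }
  apply uniform_CkLip_cohomological with phi lam
    (fun x t => partial1 (G (sg x)) (u x t, t))
    (fun x t => partial2 (G (sg x)) (u x t, t)); auto.
  - apply (uniform_CkLip_composition k W (fun i => partial1 (G i)) lo hi); auto.
    intros i. apply HC.
  - apply (uniform_CkLip_composition k W (fun i => partial2 (G i)) lo hi); auto.
    intros i. apply HC.
  - exists L. split; [ easy | ]. intros x t Hx Ht. now apply Hd.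
  - intros x t Hx Ht. now apply Hd.
Qed.

(** * Branches and conjugacies *)

(** The difference vanishes on the segment, so its slopes towards points of the segment are 0. At
    the end points this identifies the derivatives of two different extensions of one branch. *)
Lemma derive_eq_on_segment (F H : R -> R) (lo hi x l m : R) :
  lo < hi -> lo <= x <= hi ->
  (forall y, lo <= y <= hi -> F y = H y) ->
  is_derive F x l -> is_derive H x m -> l = m.
Proof.
  intros Hlh Hx Heq HF HH.
  assert (Hz : Rabs (l - m) <= 0).
  { apply derive_le_slope with (fun y => F y - H y) x.
    - now apply (is_derive_minus F H).
    (* Points are taken to the right of [x], except at [hi], where they are taken to the left. *)
    - intros e He. destruct (Rlt_dec x hi) as [Hlt | Hge].
      + exists (x + Rmin e (hi - x) / 2).
        pose proof (Rmin_l e (hi - x)). pose proof (Rmin_r e (hi - x)).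
        assert (0 < Rmin e (hi - x)) by (apply Rmin_pos; lra).
        split; [ lra | ]. split.
        * rewrite Rabs_pos_eq; lra.
        * rewrite !Heq by lra. rewrite Rmult_0_l, !Rminus_diag, Rabs_R0. lra.
      + exists (x - Rmin e (hi - lo) / 2).
        pose proof (Rmin_l e (hi - lo)). pose proof (Rmin_r e (hi - lo)).
        assert (0 < Rmin e (hi - lo)) by (apply Rmin_pos; lra).
        split; [ lra | ]. split.
        * rewrite Rabs_left1; lra.
        * rewrite !Heq by lra. rewrite Rmult_0_l, !Rminus_diag, Rabs_R0. lra. }
  pose proof (Rabs_pos (l - m)).
  apply Rminus_diag_uniq. destruct (Req_dec (l - m) 0) as [E | E]; [ easy | ].
  apply Rabs_pos_lt in E. lra.
Qed.

(** All that the regularity argument retains of one branch: a joint extension that expands uniformly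
    over a whole parameter interval. *)
Definition expanding_box (r : nat) (lo hi : R) (ft : R -> R -> R)
    (W : R * R -> Prop) (G : R * R -> R) (lam delta : R) : Prop :=
  Ck2 r W G /\
  (forall p, box lo hi delta p -> W p) /\
  (forall p, box lo hi delta p -> lam <= Rabs (partial1 G p)) /\
  (forall x t, lo <= x <= hi -> Rabs t <= delta -> G (x, t) = ft t x).

Lemma expanding_box_weaken r lo hi ft W G lam lam' delta delta' :
  lam' <= lam -> delta' <= delta ->
  expanding_box r lo hi ft W G lam delta ->
  expanding_box r lo hi ft W G lam' delta'.
Proof.
  intros Hl Hd (HC & HW & Hlam & HG).
  assert (Hbox : forall p, box lo hi delta' p -> box lo hi delta p).
  { intros p [H1 H2]. split; [ easy | lra ]. }
  split; [ easy | split; [ auto | split ] ].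
  - intros p Hp. specialize (Hlam p (Hbox p Hp)). lra.
  - intros x t Hx Ht. apply HG; [ easy | lra ].
Qed.

(** At t = 0 the derivative G_x coincides on the segment with that of the extension of f, so its
    modulus is at least some l0 > 1. Continuity and compactness keep it above (1 + l0) / 2 for small
    t. *)
Lemma expanding_box_exists r lo hi eps f ft :
  (1 <= r)%nat -> lo < hi -> 0 < eps ->
  agree_on (Icc lo hi) (ft 0) f ->
  expanding_Cr_branch r (Icc lo hi) f ->
  joint_Cr_extension r (Icc lo hi) eps ft ->
  exists W G lam delta, 1 < lam /\ 0 < delta /\
    expanding_box r lo hi ft W G lam delta.
Proof.
  intros Hr Hlh Heps Hagree (U & F & HU & HJU & HFf & [HFd _] & Hglb)
    (W & G & HW & HJW & HC & HG).
  destruct r as [ | r]; [ lia | ].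
  assert (Hl0 : exists l0, 1 < l0 /\ forall x, Icc lo hi x -> l0 <= Rabs (Derive F x)).
  { destruct (Glb_Rbar_correct
      (fun y => exists x, Icc lo hi x /\ y = Rabs (Derive F x))) as [Hlb _].
    destruct (Glb_Rbar _) as [l | | ]; [ | | easy ].
    - exists l. split; [ easy | ]. intros x Hx. apply (Hlb (Rabs (Derive F x))). eauto.
    (* An infinite infimum would mean that no slope exists at all, so the constant 2 is
       arbitrary. *)
    - exists 2. split; [ lra | ]. intros x Hx.
      destruct (Hlb (Rabs (Derive F x))). eauto. }
  destruct Hl0 as (l0 & Hl0 & HlF).
  assert (HlG : forall x, Icc lo hi x -> l0 <= Rabs (partial1 G (x, 0))).
  { intros x Hx. replace (partial1 G (x, 0)) with (Derive F x); [ auto | ].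
    apply derive_eq_on_segment with F (fun y => G (y, 0)) lo hi x; try easy.
    - intros y Hy. rewrite HG; auto; [ | rewrite Rabs_R0; easy ].
      rewrite HFf, Hagree; auto.
    - apply Derive_correct. apply (HFd 1%nat x); [ lia | auto ].
    - apply Ck2_is_derive1 with r W; auto. }
  set (lam := (1 + l0) / 2).
  (* The rectangle is the segment at height 0; the parameter range enters through the margin [d]. *)
  destruct (compact_uniform (fun d p => forall t, Rabs t < d ->
    W (fst p, t) /\ lam <= Rabs (partial1 G (fst p, t))) lo hi 0 0)
    as (d & Hd & Hbox).
  - intros d e p Hde Hp t Ht. apply Hp. lra.
  - intros u v Hu Hv. replace v with 0 by lra.
    destruct (HW _ (HJW u Hu)) as [e1 He1].
    assert (Hcont : continuous (partial1 G) (u, 0)).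
    { apply Ck2_continuous with r W; [ apply HC | auto ]. }
    assert (Hpos : 0 < l0 - lam) by (unfold lam; lra).
    destruct (proj1 (filterlim_locally _ _) Hcont (mkposreal _ Hpos)) as [e2 He2].
    exists (Rmin e1 e2). split; [ apply Rmin_pos; apply cond_pos | ].
    intros x y _ Hx _ t Ht. simpl.
    pose proof (Rmin_l e1 e2). pose proof (Rmin_r e1 e2).
    split.
    + apply He1. split; [ change (Rabs (x - u) < e1); lra | ].
      change (Rabs (t - 0) < e1). rewrite Rminus_0_r. lra.
    + assert (Hb : ball (u, 0) e2 (x, t)).
      { split; [ change (Rabs (x - u) < e2); lra | ].
        change (Rabs (t - 0) < e2). rewrite Rminus_0_r. lra. }
      specialize (He2 _ Hb).
      change (Rabs (partial1 G (x, t) - partial1 G (u, 0)) < l0 - lam) in He2.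
      specialize (HlG u Hu).
      pose proof (Rabs_triang_inv (partial1 G (u, 0)) (partial1 G (x, t))) as Htri.
      rewrite Rabs_minus_sym in Htri. lra.
  - exists W, G, lam, (Rmin d eps / 2).
    assert (Hm : 0 < Rmin d eps) by now apply Rmin_pos.
    pose proof (Rmin_l d eps). pose proof (Rmin_r d eps).
    split; [ unfold lam; lra | ]. split; [ lra | ].
    assert (Hin : forall x t, lo <= x <= hi -> Rabs t <= Rmin d eps / 2 ->
      W (x, t) /\ lam <= Rabs (partial1 G (x, t))).
    { intros x t Hx Ht. apply (Hbox x 0); lra. }
    split; [ easy | ]. split; [ | split ].
    + intros [x t] [Hx Ht]. now apply Hin.
    + intros [x t] [Hx Ht]. now apply Hin.
    + intros x t Hx Ht. apply HG; [ easy | lra | ]. now apply Hin.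
Qed.

Lemma expanding_box_dist r lo hi ft W G lam delta x y t :
  expanding_box (S r) lo hi ft W G lam delta ->
  Rabs t <= delta -> lo <= x <= hi -> lo <= y <= hi ->
  lam * Rabs (y - x) <= Rabs (ft t y - ft t x).
Proof.
  intros (HC & HW & Hlam & HG) Ht Hx Hy. rewrite <- !HG by easy.
  assert (Hbx : box lo hi delta (x, t)) by (now split).
  assert (Hby : box lo hi delta (y, t)) by (now split).
  destruct (mean_value (fun z => G (z, t)) (fun z => partial1 G (z, t)) x y)
    as (z & Hz & ->).
  - intros z Hz. apply Ck2_is_derive1 with r W; [ easy | ].
    apply HW. now apply box_segment1 with x y.
  - rewrite Rabs_mult. apply Rmult_le_compat_r; [ apply Rabs_pos | ].
    apply Hlam. now apply box_segment1 with x y.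
Qed.

(** * Homeomorphisms of the interval that fix the turning point *)

(** Projection onto [a, b] is 1-Lipschitz, so the modulus of continuity carries over. The total
    function obtained is what the intermediate value theorem takes. *)
Lemma continuous_on_clamp (a b : R) (h : R -> R) :
  a <= b -> continuous_on (Icc a b) h ->
  continuity (fun x => h (Rmax a (Rmin b x))).
Proof.
  intros Hab Hc x. apply continuity_pt_filterlim.
  assert (Hin : forall y, Icc a b (Rmax a (Rmin b y))).
  { intros y. unfold Icc, Rmax, Rmin.
    destruct (Rle_dec b y), (Rle_dec a _); lra. }
  apply filterlim_locally. intros eps.
  destruct (proj1 (filterlim_locally _ _) (Hc _ (Hin x)) eps) as [d Hd].
  exists d. intros y Hy. apply Hd; [ | auto ].
  change (Rabs (Rmax a (Rmin b y) - Rmax a (Rmin b x)) < d).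
  change (Rabs (y - x) < d) in Hy.
  apply Rle_lt_trans with (2 := Hy).
  unfold Rmax, Rmin. destruct (Rle_dec b y), (Rle_dec b x);
  repeat destruct (Rle_dec a _); unfold Rabs; repeat destruct (Rcase_abs _); lra.
Qed.

(** Otherwise the intermediate value theorem finds a point strictly on one side of c that is mapped
    to c = h(c), against injectivity. *)
Lemma homeomorphism_no_crossing (a b c : R) (h g : R -> R) (x y : R) :
  homeomorphism_with_inverse (Icc a b) h g -> a <= c <= b -> h c = c ->
  Icc a b x -> Icc a b y -> (x < c /\ y < c) \/ (c < x /\ c < y) ->
  h x <= c -> c <= h y -> False.
Proof.
  intros Hh Hc Hhc Hx Hy Hside Hhx Hhy.
  assert (Hclamp : forall z, Icc a b z -> Rmax a (Rmin b z) = z).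
  { intros z [H1 H2]. rewrite Rmin_right, Rmax_right; lra. }
  destruct (IVT_gen (fun z => h (Rmax a (Rmin b z))) x y c) as (z & Hz & Hhz).
  - apply continuous_on_clamp; [ lra | apply Hh ].
  - rewrite !Hclamp by easy. rewrite Rmin_left, Rmax_right; lra.
  - assert (Hzab : Icc a b z /\ z <> c).
    { unfold Icc, Rmin, Rmax in *. destruct (Rle_dec x y); lra. }
    destruct Hzab as [Hzab Hzc]. rewrite Hclamp in Hhz by easy.
    apply Hzc. rewrite <- (homeo_cancel_l _ _ _ Hh z Hzab), Hhz.
    rewrite <- Hhc at 1. now apply (homeo_cancel_l _ _ _ Hh).
Qed.

(** The witness [y0] rules out an exchange of sides: by absence of crossing the whole right side
    stays on the right. The preimage of a must then lie left of c, and it serves as witness for the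
    left side. *)
Lemma homeomorphism_preserves_sides (a b c y0 : R) (h g : R -> R) :
  homeomorphism_with_inverse (Icc a b) h g -> a < c < b -> h c = c ->
  c < y0 <= b -> c < h y0 ->
  forall x, Icc a b x -> (x <= c -> h x <= c) /\ (c <= x -> c <= h x).
Proof.
  intros Hh Hc Hhc Hy0 Hhy0 x Hx.
  assert (HIc : Icc a b c) by (unfold Icc; lra).
  assert (Hcross : forall z y, Icc a b z -> Icc a b y ->
    (z < c /\ y < c) \/ (c < z /\ c < y) -> h z <= c -> c <= h y -> False).
  { intros z y. apply homeomorphism_no_crossing with g; auto; lra. }
  assert (Hright : forall z, Icc a b z -> c <= z -> c <= h z).
  { intros z Hz Hcz. destruct (Req_dec z c) as [-> | Hne]; [ lra | ].
    apply Rnot_lt_le. intros Hlt. apply (Hcross z y0); auto; unfold Icc; lra. }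
  split; [ | auto ]. intros Hxc.
  destruct (Req_dec x c) as [-> | Hne]; [ lra | ].
  apply Rnot_lt_le. intros Hlt.
  assert (HIa : Icc a b a) by (unfold Icc; lra).
  pose proof (homeo_inv_maps _ _ _ Hh a HIa) as Hga.
  pose proof (homeo_cancel_r _ _ _ Hh a HIa) as Hhga.
  destruct (Rle_lt_dec c (g a)) as [H | H].
  - specialize (Hright _ Hga H). lra.
  - apply (Hcross (g a) x); auto; lra.
Qed.

(** * From uniform families to norms and joint continuity *)

Lemma bounded_upto (P : nat -> R -> Prop) (k : nat) :
  (forall j M N, M <= N -> P j M -> P j N) ->
  (forall j, (j <= k)%nat -> exists M, P j M) ->
  exists M, forall j, (j <= k)%nat -> P j M.
Proof.
  intros Hmono. induction k as [ | k IH]; intros HP.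
  - destruct (HP 0%nat) as [M HM]; [ lia | ]. exists M. intros j Hj.
    now replace j with 0%nat by lia.
  - destruct IH as [M HM]; [ auto | ].
    destruct (HP (S k)) as [N HN]; [ lia | ]. exists (Rmax M N). intros j Hj.
    destruct (Nat.eq_dec j (S k)) as [-> | Hne].
    + apply Hmono with (2 := HN). apply Rmax_r.
    + apply Hmono with M; [ apply Rmax_l | ]. apply HM. lia.
Qed.

Lemma uniform_CkLip_Derive_n {X : Type} j k (D : X -> Prop) delta w :
  (j <= k)%nat -> uniform_CkLip k D delta w ->
  uniform_CkLip (k - j) D delta (fun x => Derive_n (w x) j).
Proof.
  intros Hjk Hw. induction j as [ | j IH]; [ now rewrite Nat.sub_0_r | ].
  specialize (IH ltac:(lia)).
  replace (k - j)%nat with (S (k - S j)) in IH by lia. apply IH.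
Qed.

Lemma uniform_CkLip_derivable {X : Type} k (D : X -> Prop) delta w x :
  uniform_CkLip k D delta w -> D x ->
  derivable_upto k (fun t => Rabs t < delta) (w x).
Proof.
  intros Hw Hx j t Hj Ht. destruct j as [ | j]; [ easy | ].
  pose proof (uniform_CkLip_Derive_n j k D delta w ltac:(lia) Hw) as Hd.
  replace (k - j)%nat with (S (k - S j)) in Hd by lia. now apply Hd.
Qed.

(** [J] will be a closed interval inside the open one, so the two-sided derivatives make sense at
    its end points. The norm is a maximum, hence the bound [Rmax M L]. *)
Lemma uniform_CkLip_norm {X : Type} k (D : X -> Prop) delta w (J : R -> Prop) :
  uniform_CkLip k D delta w -> (forall t, J t -> Rabs t < delta) ->
  (forall x, D x -> CkLip k J (w x)) /\
  exists M : R, forall x, D x -> Rbar_le (CkLip_norm k J (w x)) M.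
Proof.
  intros Hw HJ.
  pose proof (uniform_CkLip_Derive_n k k D delta w (le_n k) Hw) as Hd.
  apply uniform_CkLip_lipschitz in Hd. destruct Hd as (L & HL0 & HL).
  split.
  - intros x Hx. split.
    + intros j t Hj Ht. apply uniform_CkLip_derivable with k D delta; auto.
    + exists L. auto.
  - destruct (bounded_upto (fun j M => forall x t, D x -> Rabs t < delta ->
      Rabs (Derive_n (w x) j t) <= M) k) as [M HM].
    + intros j M N HMN HM x t Hx Ht. specialize (HM x t Hx Ht). lra.
    + intros j Hj. pose proof (uniform_CkLip_Derive_n j k D delta w Hj Hw) as Hdj.
      apply uniform_CkLip_bounded in Hdj. destruct Hdj as (M & _ & HM). eauto.
    + exists (Rmax M L). intros x Hx.
      apply (proj2 (Lub_Rbar_correct _)). intros y [Hy | Hy]; simpl.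
      * destruct Hy as (j & t & Hj & Ht & ->).
        apply Rle_trans with (2 := Rmax_l _ _). auto.
      * destruct Hy as (s & t & Hs & Ht & Hst & ->).
        apply Rle_trans with (2 := Rmax_r _ _).
        assert (0 < Rabs (s - t)) by (apply Rabs_pos_lt; lra).
        apply Rmult_le_reg_r with (Rabs (s - t)); [ easy | ].
        unfold Rdiv. rewrite Rmult_assoc, Rinv_l, Rmult_1_r by lra. auto.
Qed.

(** Split h_s(y) - h_t(x) at h_t(y): the first part is controlled by the Lipschitz bound uniformly
    in y, the second by continuity of the single map h_t. *)
Lemma uniform_lipschitz_continuous_on (D : R -> Prop) delta (h : R -> R -> R)
    (J : R -> Prop) :
  (forall t, J t -> Rabs t < delta) ->
  uniform_lipschitz D delta (fun x t => h t x) ->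
  (forall t, J t -> continuous_on D (h t)) ->
  continuous_on (fun p : R * R => J (fst p) /\ D (snd p))
    (fun p => h (fst p) (snd p)).
Proof.
  intros HJ (L & HL0 & HL) Hc [t x] [Ht Hx]. simpl in Ht, Hx.
  apply filterlim_locally. intros eps.
  assert (He2 : 0 < eps / 2) by (pose proof (cond_pos eps); lra).
  destruct (proj1 (filterlim_locally _ _) (Hc t Ht x Hx) (mkposreal _ He2))
    as [d Hd].
  assert (Hd2 : 0 < Rmin d (eps / 2 / (L + 1))).
  { apply Rmin_pos; [ apply cond_pos | ]. apply Rdiv_lt_0_compat; lra. }
  exists (mkposreal _ Hd2). intros [s y] [Hs Hy] [HJs HDy].
  change (Rabs (s - t) < Rmin d (eps / 2 / (L + 1))) in Hs.
  change (Rabs (y - x) < Rmin d (eps / 2 / (L + 1))) in Hy.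
  pose proof (Rmin_l d (eps / 2 / (L + 1))).
  pose proof (Rmin_r d (eps / 2 / (L + 1))). simpl in HJs, HDy.
  assert (Hbyx : ball x d y) by (change (Rabs (y - x) < d); lra).
  specialize (Hd y Hbyx HDy). change (Rabs (h t y - h t x) < eps / 2) in Hd.
  change (Rabs (h s y - h t x) < eps).
  specialize (HL y s t HDy (HJ s HJs) (HJ t Ht)). simpl in HL.
  replace (h s y - h t x) with ((h s y - h t y) + (h t y - h t x)) by ring.
  apply Rle_lt_trans with (1 := Rabs_triang _ _).
  assert (Hlt : (L + 1) * Rabs (s - t) < eps / 2).
  { apply Rlt_le_trans with ((L + 1) * (eps / 2 / (L + 1))).
    - apply Rmult_lt_compat_l; lra.
    - right. field. lra. }
  pose proof (Rabs_pos (s - t)). lra.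
Qed.

Theorem proposition2p4 (a c b : R) (hac : a < c) (hcb : c < b)
    (r0 : nat) (hr0 : (2 <= r0)%nat)
    (f : R -> R) (hf : pw_expanding_unimodal a c b r0 f)
    (ft : R -> R -> R) (hft : perturbation a c b r0 r0 f ft)
    (h : R -> R -> R)
    (hh : exists delta : R, 0 < delta /\ forall t, Rabs t < delta ->
       exists g : R -> R,
         homeomorphism_with_inverse (Icc a b) (h t) g /\
         h t c = c /\
         forall x, Icc a b x -> ft t x = h t (f (g x))) :
  exists eps0 : R, 0 < eps0 /\ forall eps, 0 < eps -> eps < eps0 ->
    continuous_on (fun p : R * R => (- eps < fst p < eps) /\ Icc a b (snd p))
      (fun p => h (fst p) (snd p)) /\
    (forall x, Icc a b x -> CkLip (r0 - 1) (Icc (- eps) eps) (fun t => h t x)) /\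
    exists M : R, forall x, Icc a b x ->
      Rbar_le (CkLip_norm (r0 - 1) (Icc (- eps) eps) (fun t => h t x)) M.
Proof.
  destruct hft as (e0 & He0 & Huni & Hagree & _ & _ & Hjp & Hjm).
  destruct hh as (d0 & Hd0 & Hh).
  destruct (expanding_box_exists r0 a c e0 f ft) as (Wp & Gp & lp & dp & Hlp & Hdp & Hbp);
    auto; [ lia | intros x Hx; apply Hagree; unfold Icc in *; lra
          | apply hf | ].
  destruct (expanding_box_exists r0 c b e0 f ft) as (Wm & Gm & lm & dm & Hlm & Hdm & Hbm);
    auto; [ lia | intros x Hx; apply Hagree; unfold Icc in *; lra
          | apply hf | ].
  set (lam := Rmin lp lm).
  set (delta := Rmin (Rmin dp dm) (Rmin d0 e0)).
  assert (Hlam : 1 < lam /\ lam <= lp /\ lam <= lm).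
  { unfold lam. split; [ now apply Rmin_glb_lt | ].
    split; [ apply Rmin_l | apply Rmin_r ]. }
  assert (Hdelta : 0 < delta /\ delta <= dp /\ delta <= dm /\ delta <= d0 /\ delta <= e0).
  { pose proof (Rmin_l dp dm). pose proof (Rmin_r dp dm).
    pose proof (Rmin_l d0 e0). pose proof (Rmin_r d0 e0).
    pose proof (Rmin_l (Rmin dp dm) (Rmin d0 e0)).
    pose proof (Rmin_r (Rmin dp dm) (Rmin d0 e0)).
    split; [ now repeat apply Rmin_pos | ]. unfold delta. lra. }
  destruct Hlam as (Hlam & Hlamp & Hlamm).
  destruct Hdelta as (Hdelta & Hddp & Hddm & Hdd0 & Hde0).
  apply (expanding_box_weaken _ _ _ _ _ _ _ lam _ delta Hlamp Hddp) in Hbp.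
  apply (expanding_box_weaken _ _ _ _ _ _ _ lam _ delta Hlamm Hddm) in Hbm.
  destruct r0 as [ | r]; [ lia | ].
  replace (S r - 1)%nat with r by lia.
  (* Expansion on the increasing branch gives f_t(c) - a >= lam (c - a) > c - a. *)
  assert (Hpeak : forall t, Rabs t < delta -> c < ft t c).
  { intros t Ht. pose proof (Huni t ltac:(lra)) as Hut.
    pose proof (expanding_box_dist r a c ft Wp Gp lam delta a c t Hbp
      ltac:(lra) ltac:(lra) ltac:(lra)) as Hdist.
    pose proof (unimodal_left _ _ _ _ _ Hut) as Hl.
    assert (Hac : ft t a < ft t c)
      by (apply (unimodal_increasing _ _ _ _ _ Hut); unfold Icc; lra).
    rewrite !Rabs_pos_eq in Hdist by lra. nra. }
  assert (HIc : Icc a b c) by (unfold Icc; lra).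
  assert (Hrange : c < f c <= b).
  { split.
    - rewrite <- Hagree by easy. apply Hpeak. rewrite Rabs_R0. easy.
    - apply (unimodal_maps _ _ _ _ _ hf). easy. }
  assert (Hsides : forall t, Rabs t < delta -> forall x, Icc a b x ->
    Icc a b (h t x) /\ h t (f x) = ft t (h t x) /\
    (x <= c -> h t x <= c) /\ (c <= x -> c <= h t x)).
  { intros t Ht x Hx. destruct (Hh t ltac:(lra)) as (g & Hg & Hhc & Hconj).
    assert (Hcomm : forall y, Icc a b y -> h t (f y) = ft t (h t y)).
    { intros y Hy. rewrite Hconj by now apply (homeo_maps _ _ _ Hg).
      now rewrite (homeo_cancel_l _ _ _ Hg). }
    split; [ now apply (homeo_maps _ _ _ Hg) | ]. split; [ auto | ].
    (* The witness on the right is f(c): it lies right of c, and so does its image h_t(f(c)) =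
       f_t(h_t(c)) = f_t(c). *)
    apply (homeomorphism_preserves_sides a b c (f c) (h t) g); auto.
    rewrite Hcomm, Hhc by easy. auto. }
  assert (Hreg : uniform_CkLip r (Icc a b) delta (fun x t => h t x)).
  { destruct Hbp as (HCp & HWp & Hep & HGp), Hbm as (HCm & HWm & Hem & HGm).
    (* The base dynamics is f itself on I, and [true] denotes the increasing branch, to which the
       point c is assigned. *)
    apply (uniform_CkLip_conjugacy r (fun i : bool => if i then Wp else Wm)
      (fun i : bool => if i then Gp else Gm)
      (fun i : bool => if i then a else c) (fun i : bool => if i then c else b)
      delta lam (Icc a b) (fun x => if Rle_dec x c then true else false) f);
      try (intros [ | ]; assumption); try assumption.
    - apply (unimodal_maps _ _ _ _ _ hf).
    - intros x t Hx Ht. destruct (Hsides t Ht x Hx) as ([H1 H2] & _ & H3 & H4).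
      destruct (Rle_dec x c) as [Hxc | Hxc].
      + split; [ easy | now apply H3 ].
      + split; [ apply H4; lra | easy ].
    - intros x t Hx Ht. destruct (Hsides t Ht x Hx) as ([H1 H2] & -> & H3 & H4).
      destruct (Rle_dec x c).
      + rewrite HGp; auto; lra.
      + rewrite HGm; auto; lra. }
  (* The strict inequality [eps < delta] places the closed interval [-eps, eps] inside the open one
     where the family is regular. *)
  exists delta. split; [ easy | ]. intros eps Heps Hed.
  assert (Hclosed : forall t, Icc (- eps) eps t -> Rabs t < delta).
  { intros t Ht. apply Rle_lt_trans with eps; [ now apply Rabs_le | easy ]. }
  split; [ | now apply uniform_CkLip_norm with delta ].
  apply (uniform_lipschitz_continuous_on (Icc a b) delta h (fun t => - eps < t < eps)).
  - intros t Ht. apply Hclosed. unfold Icc. lra.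
  - now apply uniform_CkLip_lipschitz in Hreg.
  - intros t Ht. destruct (Hh t) as (g & Hg & _).
    + apply Rlt_le_trans with delta; [ | easy ]. apply Hclosed. unfold Icc. lra.
    + apply Hg.
Qed.
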